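(* Let $\Omega$ be a finite state space, and let $P_{initial}=\{p_{i,j}^{initial}\}$ and $P_{final}=\{p_{i,j}^{final}\}$ be transition probability matrices on $\Omega$, where $P_{final}$ has a unique stationary distribution $\pi_f$. For all $i,j\in\Omega$ let $\phi_{i,j}:[0,1]\to[0,1]$ be continuous functions with $\phi_{i,j}(0)=0$ and $\phi_{i,j}(1)=1$, and for $s\in[0,1]$ let $P_s=\{p_{i,j}[s]\}$, where $$p_{i,j}[s]=(1-\phi_{i,j}(s))\,p_{i,j}^{initial}+\phi_{i,j}(s)\,p_{i,j}^{final}.$$ Let $P_{\frac{t}{T}}=\left\{p_{i,j}\left[\frac{t}{T}\right]\right\}$ be an inhomogeneous discrete-time Markov chain over $[0,T]$. Let $\phi(s)=\min_{i,j}\phi_{i,j}(s)$ be the pointwise minimum function of all of the functions $\phi_{i,j}$. If $m\ge 1$ is an integer such that $\phi$ is $m+1$ times continuously differentiable in a neighborhood of $1$, $\phi^{(k)}(1)=0$ for all integers $k$ such that $1\le k<m$, and $\phi^{(m)}(1)\neq 0$, then the adiabatic time $T_\epsilon$ satisfies $$T_{\epsilon}=\mathcal{O}\left(\frac{t_{mix}^{\frac{m+1}{m}}(\epsilon/2)}{\epsilon^{\frac{1}{m}}}\right),$$ where $t_{mix}$ denotes the mixing time for $P_{final}$ and $t_{mix}^{\frac{m+1}{m}}(\epsilon/2)$ means $\left(t_{mix}(\epsilon/2)\right)^{\frac{m+1}{m}}$.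
   Context: Probability distributions on $\Omega$ are row vectors, and $\|\cdot\|_{TV}$ denotes the total variation distance. Mixing time: given $\epsilon>0$, the mixing time of $P_{final}$ is $t_{mix}(\epsilon)=\inf\{t:\|\nu P_{final}^{t}-\pi_f\|_{TV}\le\epsilon\text{ for all probability distributions }\nu\}$, where $t$ is discrete time. Adiabatic time: given $\epsilon>0$, $T_\epsilon$ is the least $T$ such that $$\max_{\nu}\left\|\nu P_{\frac{1}{T}}P_{\frac{2}{T}}\cdots P_{\frac{T-1}{T}}P_{1}-\pi_f\right\|_{TV}\le\epsilon,$$ where the maximum is taken over all probability distributions $\nu$ over $\Omega$. *)

(* Defs.v *)
From mathcomp Require Import all_boot all_order all_algebra.
From mathcomp Require Import all_classical all_reals all_analysis.

Set Implicit Arguments.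
Unset Strict Implicit.
Unset Printing Implicit Defensive.

Import Order.TTheory GRing.Theory Num.Theory.
Import numFieldNormedType.Exports.

Local Open Scope classical_set_scope.
Local Open Scope ring_scope.

Definition is_distribution (R : realType) (n : nat) (nu : 'rV[R]_n) : Prop :=
  (forall i, 0 <= nu ord0 i) /\ \sum_i nu ord0 i = 1.

Definition is_transition (R : realType) (n : nat) (P : 'M[R]_n) : Prop :=
  forall i, is_distribution (row i P).

Definition is_unique_stationary (R : realType) (n : nat) (P : 'M[R]_n)
    (pi : 'rV[R]_n) : Prop :=
  [/\ is_distribution pi, pi *m P = pi &
      forall mu : 'rV[R]_n, is_distribution mu -> mu *m P = mu -> mu = pi].

(* Normalized so that two distributions are at distance at most 1. *)
Definition tv_dist (R : realType) (n : nat) (mu nu : 'rV[R]_n) : R :=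
  \big[Num.max/0]_(A : {set 'I_n})
    `|\sum_(i in A) mu ord0 i - \sum_(i in A) nu ord0 i|.

(* Infima of sets of times are taken in the extended reals, so that a time that
   is never reached is +oo, as for the mixing time of a periodic chain. *)
Definition mixing_time (R : realType) (n : nat) (P : 'M[R]_n) (pi : 'rV[R]_n)
    (eps : R) : \bar R :=
  ereal_inf [set t%:R%:E | t in
    [set t : nat | forall nu : 'rV[R]_n, is_distribution nu ->
       tv_dist (nu *m P ^+ t) pi <= eps]].

Definition interpolation (R : realType) (n : nat) (P Q : 'M[R]_n)
    (phi : 'I_n -> 'I_n -> R -> R) (s : R) : 'M[R]_n :=
  \matrix_(i, j) ((1 - phi i j s) * P i j + phi i j s * Q i j).

(* For T = 0 the product is empty: the chain makes no step. *)
Definition adiabatic_time (R : realType) (n : nat) (P : R -> 'M[R]_n)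
    (pi : 'rV[R]_n) (eps : R) : \bar R :=
  ereal_inf [set T%:R%:E | T in
    [set T : nat |
       (ereal_sup [set (tv_dist
            (nu *m \prod_(1 <= t < T.+1) P (t%:R / T%:R)) pi)%:E
          | nu in [set nu : 'rV[R]_n | is_distribution nu]]
        <= eps%:E)%E]].

(* On [0, 1], where the phi i j are at most 1, the default value 1 does not
   affect the minimum. *)
Definition pointwise_min (R : realType) (n : nat)
    (phi : 'I_n -> 'I_n -> R -> R) (s : R) : R :=
  \big[Num.min/1]_i \big[Num.min/1]_j phi i j s.

(* Derivatives of a function whose domain is A: increments stay in A, so the
   derivative is one-sided at an endpoint of an interval, and agrees with the
   usual one in its interior. *)
Definition diff_quotient (R : realType) (f : R -> R) (x h : R) : R :=
  h^-1 * (f (x + h) - f x).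

Definition derivable_on (R : realType) (A : set R) (f : R -> R) (x : R) : Prop :=
  cvg (diff_quotient f x h @[h --> within [set h | A (x + h)] 0^']).

Definition derive_on (R : realType) (A : set R) (f : R -> R) (x : R) : R :=
  lim (diff_quotient f x h @[h --> within [set h | A (x + h)] 0^']).

Definition derive_onn (R : realType) (A : set R) (k : nat) (f : R -> R)
    : R -> R :=
  iter k (derive_on A) f.

Definition continuously_derivable_near (R : realType) (A : set R) (k : nat)
    (f : R -> R) (a : R) : Prop :=
  \forall x \near within A (nbhs a),
    (forall l, (l < k)%N -> derivable_on A (derive_onn A l f) x) /\
    derive_onn A k f y @[y --> within A (nbhs x)] --> derive_onn A k f x.

(* Main.v *)
(* The interpolated matrices dominate phi(s) Pfinal entrywise, since every
   phi_ij is at least phi.  If phi >= 1 - b along the last t steps, the law at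
   time T therefore dominates (1 - b)^t times mu Pfinal^t, where mu is the law
   at time T - t, so it lies within 1 - (1 - b)^t <= t b of it in total
   variation.  With t = t_mix(eps/2), the law of mu Pfinal^t is eps/2-close to
   pi_f.  Integrating the vanishing derivatives from 1 gives
   1 - phi(s) <= M (1 - s)^m near 1, hence b = M (t/T)^m, and t b <= eps/2 as
   soon as T^m >= 2 M t^(m+1) / eps. *)
Require Import Defs.
From mathcomp Require Import all_boot all_order all_algebra.
From mathcomp Require Import all_classical all_reals all_analysis.
From mathcomp Require Import ring lra.

Set Implicit Arguments.
Unset Strict Implicit.
Unset Printing Implicit Defensive.

Import Order.TTheory GRing.Theory Num.Theory.
Import numFieldNormedType.Exports.

Local Open Scope classical_set_scope.
Local Open Scope ring_scope.

(** * One-sided derivatives and the flatness of [phi] at 1 *)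

(** Close to [x] the difference quotient is within 1 of its limit [l], so [|l| + 1] serves as the
    constant. *)
Lemma derivable_on_lipschitz (R : realType) (A : set R) (f : R -> R) (x : R) :
  derivable_on A f x ->
  exists2 K : R, 0 < K &
    \forall y \near within A (nbhs x), `|f y - f x| <= K * `|y - x|.
Proof.
move=> /cvg_ex[l] /cvgrPdist_lt /(_ 1 ltr01).
rewrite near_withinE /dnbhs near_withinE => /nbhs_ballP[e /= e0 fe].
exists (`|l| + 1); first by rewrite ltr_pwDr.
rewrite near_withinE; apply/nbhs_ballP; exists e => //= y xy Ay.
have [->|yx] := eqVneq y x; first by rewrite !subrr normr0 mulr0.
have : `|l - diff_quotient f x (y - x)| < 1.
  apply: fe; last by rewrite addrC subrK.
    by rewrite /ball /= sub0r normrN distrC.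
  by rewrite subr_eq0.
rewrite /diff_quotient [x + _]addrC subrK => h.
have {}h : `|(y - x)^-1 * (f y - f x)| <= `|l| + 1.
  rewrite -[X in `|X|](subKr l).
  by rewrite (le_trans (ler_normB _ _)) // lerD2l ltW.
by move: h; rewrite normrM normfV mulrC ler_pdivrMr // normr_gt0 subr_eq0.
Qed.

Lemma derivable_on_continuous (R : realType) (A : set R) (f : R -> R) (x : R) :
  derivable_on A f x -> f y @[y --> within A (nbhs x)] --> f x.
Proof.
move=> /derivable_on_lipschitz[K K0]; rewrite near_withinE => fK.
apply/cvgrPdist_lt => e e0; rewrite near_withinE.
near=> y => Ay; rewrite distrC.
apply: (@le_lt_trans _ _ (K * `|y - x|)); first by move: Ay; near: y.
rewrite mulrC -ltr_pdivlMr // distrC; near: y.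
by apply/nbhs_ballP; exists (e / K) => //=; rewrite divr_gt0.
Unshelve. all: by end_near. Qed.

Lemma is_derive_on_interior (R : realType) (A : set R) (f : R -> R) (x : R) :
  nbhs x A -> derivable_on A f x -> is_derive x 1 f (derive_on A f x).
Proof.
move=> /nbhs_ballP[e /= e0 xA].
(* Since [A] is a neighbourhood of [x], all small increments stay in it, so restricting them changes
   nothing and [derive_on] becomes the usual derivative. *)
have filterE : within [set h | A (x + h)] 0^' = 0^'.
  apply/seteqP; split=> [P|P]; last by apply: cvg_within.
  move=> AP.
  have {}AP : \forall h \near 0, h != 0 -> A (x + h) -> P h by exact: AP.
  suff : \forall h \near 0, h != 0 -> P h by [].
  near=> h => h0; apply: (near AP h) => //; apply: xA.
  near: h; apply/nbhs_ballP; exists e => //= z.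
  by rewrite /ball /= sub0r opprD addrA subrr sub0r.
have quotE : diff_quotient f x = fun h => h^-1 *: (f (h *: 1 + x) - f x).
  by apply/funext => h; rewrite /diff_quotient [h *: 1]mulr1 [h + x]addrC.
rewrite /derivable_on /derive_on filterE quotE => fx.
exact: DeriveDef.
Unshelve. all: by end_near. Qed.

(** The mean value theorem needs two-sided derivatives only on []a, 1[], which is interior to
    [[0, 1]]; at the endpoint 1 one-sided continuity suffices. *)
Lemma derivable_on_unit_MVT (R : realType) (f : R -> R) (a : R) :
  0 < a -> a < 1 ->
  (forall x, a <= x <= 1 -> derivable_on `[0, 1] f x) ->
  exists2 c, a < c < 1 & f 1 - f a = derive_on `[0, 1] f c * (1 - a).
Proof.
move=> a0 a1 df.
have derf c : c \in `]a, 1[ -> is_derive c 1 f (derive_on `[0, 1] f c).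
  rewrite in_itv /= => /andP[ac c1]; apply: is_derive_on_interior.
    have : \forall y \near c, y \in `]0, 1[
      by apply: near_in_itvoo; rewrite in_itv /= (lt_trans a0).
    by apply: filterS => y; apply: subset_itv_oo_cc.
  by apply: df; rewrite !ltW.
have [|c] := MVT a1 derf; last by rewrite in_itv /= => ac ?; exists c.
apply/subspace_continuousP => x /=; rewrite in_itv /= => xa1.
apply: cvg_trans (derivable_on_continuous (df x xa1)).
apply: cvg_app; apply: within_subset => y /=; rewrite !in_itv /=.
by case/andP=> ay ->; rewrite (le_trans _ ay) // ltW.
Qed.

(** The derivative of order [m] is bounded near 1. Each use of the mean value theorem lowers the
    order by one and gains a factor [1 - s], the derivatives in between vanishing at 1. *)
Lemma flat_unit_bound (R : realType) (phi : R -> R) (m : nat) :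
  (0 < m)%N -> continuously_derivable_near `[0, 1] m.+1 phi 1 ->
  (forall k : nat, (1 <= k < m)%N -> derive_onn `[0, 1] k phi 1 = 0) ->
  exists d M : R, [/\ 0 < d, d < 1, 0 < M &
    forall s, 1 - d <= s <= 1 -> `|phi 1 - phi s| <= M * (1 - s) ^+ m].
Proof.
move=> m0; rewrite /continuously_derivable_near near_withinE.
move=> /nbhs_ballP[e /= e0 smooth] flat.
pose D k := derive_onn `[0, 1] k phi.
have derD k x : (k < m.+1)%N -> 0 <= x <= 1 -> `|1 - x| < e ->
    derivable_on `[0, 1] (D k) x.
  by move=> km x01 xe; apply: (smooth x xe _).1 => //=; rewrite in_itv.
have [|K K0] := @derivable_on_lipschitz R `[0, 1] (D m) 1.
  by apply: derD; rewrite ?subrr ?normr0 ?ler01 ?lexx.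
rewrite near_withinE => /nbhs_ballP[e' /= e'0 lipD].
(* Halving keeps [d] strictly inside both radii; the cap 1/2 keeps [[1 - d, 1]] away from 0, as the
   mean value step requires. *)
have [d [d0 de de' d12]] : exists d, [/\ 0 < d, d < e, d < e' & d <= 1 / 2].
  exists (Num.min (Num.min (e / 2) (e' / 2)) (1 / 2)).
  have [e2 e'2] : e / 2 < e /\ e' / 2 < e' by split; lra.
  split; first by rewrite !lt_min !divr_gt0.
  - by rewrite !gt_min e2.
  - by rewrite !gt_min e'2 orbT.
  - by rewrite ge_min lexx orbT.
pose M := `|D m 1| + K.
have M0 : 0 < M by rewrite ltr_wpDl.
have inD x : 1 - d <= x <= 1 -> [/\ 0 <= x <= 1, `|1 - x| < e & `|1 - x| < e'].
  move=> /andP[dx x1]; rewrite ger0_norm; last by lra.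
  by split; lra.
have boundD x : 1 - d <= x <= 1 -> `|D m x| <= M.
  move=> xd; have [x01 _ xe'] := inD x xd.
  have /= := lipD x xe'; rewrite in_itv /= => /(_ x01) Dx.
  rewrite -[X in `|X|](subrK (D m 1)) (le_trans (ler_normD _ _)) // addrC lerD2l.
  rewrite (le_trans Dx) // distrC ger0_norm; last by lra.
  by rewrite ler_piMr ?ltW //; lra.
have stepD k s B : (k < m)%N -> 1 - d <= s < 1 ->
    (forall c, s < c < 1 -> `|D k.+1 c| <= B) ->
    `|D k 1 - D k s| <= B * (1 - s).
  move=> km sd HB; have [|||c sc ->] := @derivable_on_unit_MVT R (D k) s.
  - lra.
  - lra.
  - move=> x sx; have [|x01 xe _] := inD x; first by lra.
    by apply: derD => //; apply: ltnW.
  - rewrite normrM (ger0_norm (x := 1 - s)); last by lra.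
    by rewrite ler_pM2r ?(HB c sc) //; lra.
have Dbound j s : (j < m)%N -> 1 - d <= s <= 1 ->
    `|D (m - j.+1)%N 1 - D (m - j.+1)%N s| <= M * (1 - s) ^+ j.+1.
  (* The case [s = 1] is split off because the mean value theorem needs a nondegenerate interval. *)
  elim: j s => [|j IH] s jm /andP[ds]; rewrite le_eqVlt => /predU1P[->|s1].
  - by rewrite !subrr normr0 expr0n mulr0.
  - apply: stepD => [||c sc]; rewrite ?ds ?s1 // ?subn1 ?prednK //.
    by apply: boundD; lra.
  - by rewrite !subrr normr0 expr0n mulr0.
  - rewrite exprSr mulrA; apply: stepD => [||c sc]; rewrite ?ds ?s1 //.
      by rewrite ltn_subrL m0.
    rewrite subnSK //; have := IH c (ltnW jm).
    (* Here [0 < m - j.+1 < m], so flatness turns the bound on a difference into a bound on the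
       derivative itself. *)
    have -> : D (m - j.+1)%N 1 = 0 by rewrite /D flat // subn_gt0 jm ltn_subrL.
    rewrite sub0r normrN => IHc; apply: le_trans (IHc _) _; first by lra.
    by rewrite ler_pM2l // lerXn2r ?nnegrE; lra.
exists d, M; split=> //; first by lra.
move=> s sd; have := Dbound m.-1 s; rewrite prednK // subnn.
exact.
Qed.

(** * Total variation distance *)

Lemma tv_dist_le (R : realType) (n : nat) (mu nu : 'rV[R]_n) (e : R) :
  0 <= e ->
  (forall A : {set 'I_n},
    `|\sum_(i in A) mu ord0 i - \sum_(i in A) nu ord0 i| <= e) ->
  tv_dist mu nu <= e.
Proof. by move=> e0 H; apply: bigmax_le. Qed.

Lemma sum_le_tv_dist (R : realType) (n : nat) (mu nu : 'rV[R]_n)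
    (A : {set 'I_n}) :
  `|\sum_(i in A) mu ord0 i - \sum_(i in A) nu ord0 i| <= tv_dist mu nu.
Proof.
exact: (le_bigmax 0 (fun A : {set 'I_n} =>
  `|\sum_(i in A) mu ord0 i - \sum_(i in A) nu ord0 i|)).
Qed.

Lemma tv_dist_triangle (R : realType) (n : nat) (mu nu rho : 'rV[R]_n) :
  tv_dist mu rho <= tv_dist mu nu + tv_dist nu rho.
Proof.
apply: tv_dist_le => [|A].
  rewrite addr_ge0 //; exact: le_trans (sum_le_tv_dist _ _ finset.set0).
rewrite (le_trans (ler_distD (\sum_(i in A) nu ord0 i) _ _)) //.
by rewrite lerD // sum_le_tv_dist.
Qed.

Lemma distribution_sum01 (R : realType) (n : nat) (nu : 'rV[R]_n)
    (A : {set 'I_n}) :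
  is_distribution nu -> 0 <= \sum_(i in A) nu ord0 i <= 1.
Proof.
move=> [nu0 nu1]; rewrite sumr_ge0 //= -nu1 [leRHS](bigID (mem A)) /=.
by rewrite lerDl sumr_ge0.
Qed.

Lemma tv_dist_le1 (R : realType) (n : nat) (mu nu : 'rV[R]_n) :
  is_distribution mu -> is_distribution nu -> tv_dist mu nu <= 1.
Proof.
move=> dmu dnu; apply: tv_dist_le => // A.
have := distribution_sum01 A dmu; have := distribution_sum01 A dnu.
rewrite ler_norml; lra.
Qed.

(** * Transition matrices and their products *)

Lemma mulmx_distribution (R : realType) (n : nat) (nu : 'rV[R]_n)
    (P : 'M[R]_n) :
  is_distribution nu -> is_transition P -> is_distribution (nu *m P).
Proof.
move=> [nu0 nu1] tP; have P0 i j : 0 <= P i j.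
  by have [+ _] := tP i => /(_ j); rewrite mxE.
have P1 i : \sum_j P i j = 1.
  by have [_ <-] := tP i; apply: eq_bigr => j _; rewrite mxE.
split=> [j|].
  by rewrite mxE sumr_ge0 // => i _; rewrite mulr_ge0.
under eq_bigr do rewrite mxE.
rewrite exchange_big -nu1 /=; apply: eq_bigr => i _.
by rewrite -mulr_sumr P1 mulr1.
Qed.

Lemma transition1 (R : realType) (n : nat) : is_transition (1 : 'M[R]_n).
Proof.
move=> i; split=> [j|]; first by rewrite !mxE ler0n.
rewrite (bigD1 i) //= big1 ?addr0 => [|j ij]; rewrite !mxE ?eqxx //.
by rewrite eq_sym (negPf ij).
Qed.

Lemma transitionM (R : realType) (n : nat) (P Q : 'M[R]_n) :
  is_transition P -> is_transition Q -> is_transition (P *m Q).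
Proof. by move=> tP tQ i; rewrite row_mul; apply: mulmx_distribution. Qed.

Lemma transition_prod (R : realType) (n : nat) (I : eqType) (r : seq I)
    (P : I -> 'M[R]_n) :
  (forall i, i \in r -> is_transition (P i)) ->
  is_transition (\prod_(i <- r) P i).
Proof.
move=> tP; rewrite big_seq; elim/big_ind: _ => //; first exact: transition1.
exact: transitionM.
Qed.

Lemma transition_exp (R : realType) (n : nat) (P : 'M[R]_n) (t : nat) :
  is_transition P -> is_transition (P ^+ t).
Proof.
move=> tP; elim: t => [|t IH]; first exact: transition1.
by rewrite exprS; apply: transitionM.
Qed.

(** * Minorization of products, of distributions and of interpolated matrices *)

(** All entries involved are nonnegative, so entrywise lower bounds multiply. *)
Lemma prod_ge_exp (R : realType) (n : nat) (I : eqType) (r : seq I)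
    (P : I -> 'M[R]_n) (Q : 'M[R]_n) (c : R) :
  0 <= c -> (forall i j, 0 <= Q i j) ->
  (forall k i j, k \in r -> c * Q i j <= P k i j) ->
  forall i j, c ^+ size r * (Q ^+ size r) i j <= (\prod_(k <- r) P k) i j.
Proof.
move=> c0 Q0; elim: r => [|k r IH] cQP i j; first by rewrite big_nil expr0 mul1r.
have Qr0 a b : 0 <= (Q ^+ size r) a b.
  elim: (size r) a b => [|s IHs] a b; first by rewrite mxE ler0n.
  by rewrite exprS mxE sumr_ge0 // => l _; rewrite mulr_ge0.
rewrite big_cons /= !exprS !mxE mulr_sumr ler_sum // => l _.
rewrite mulrACA ler_pM ?mulr_ge0 ?exprn_ge0 ?cQP ?mem_head //.
by apply: IH => a b u ar; apply: cQP; rewrite inE ar orbT.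
Qed.

(** On any event [mu] falls short of [nu] by at most [1 - c] times the [nu]-mass of the event.
    Applied to the complement, the same bound limits the excess, as both total masses are 1. *)
Lemma tv_dist_minorized (R : realType) (n : nat) (mu nu : 'rV[R]_n) (c : R) :
  is_distribution mu -> is_distribution nu -> c <= 1 ->
  (forall j, c * nu ord0 j <= mu ord0 j) -> tv_dist mu nu <= 1 - c.
Proof.
move=> dmu dnu c1 cnu; apply: tv_dist_le => [|A]; first by rewrite subr_ge0.
have sumC (rho : 'rV[R]_n) : is_distribution rho ->
    \sum_(i in A) rho ord0 i + \sum_(i in ~: A) rho ord0 i = 1.
  move=> [_ <-]; rewrite [RHS](bigID (mem A)) /=; congr (_ + _).
  by apply: eq_bigl => i; rewrite inE.
have minor (B : {set 'I_n}) :
    c * \sum_(i in B) nu ord0 i <= \sum_(i in B) mu ord0 i.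
  by rewrite mulr_sumr ler_sum.
have := minor A; have := minor (~: A).
have := sumC mu dmu; have := sumC nu dnu.
have := distribution_sum01 A dnu; have := distribution_sum01 (~: A) dnu.
rewrite ler_norml; nra.
Qed.

Lemma bernoulli_ineq (R : realDomainType) (b : R) (t : nat) :
  0 <= b <= 1 -> 1 - t%:R * b <= (1 - b) ^+ t.
Proof.
move=> b01; elim: t => [|t IH]; first by rewrite mul0r subr0.
rewrite exprS -natr1; apply: le_trans (ler_wpM2l _ IH); last by lra.
have : 0 <= t%:R * b ^+ 2 by rewrite mulr_ge0 ?ler0n ?sqr_ge0.
lra.
Qed.

Lemma pointwise_min_le (R : realType) (n : nat) (phis : 'I_n -> 'I_n -> R -> R)
    (s : R) (i j : 'I_n) : pointwise_min phis s <= phis i j s.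
Proof.
exact: le_trans (bigmin_le_cond _ (j := i) _ isT) (bigmin_le_cond _ (j := j) _ isT).
Qed.

Lemma pointwise_min_eq1 (R : realType) (n : nat)
    (phis : 'I_n -> 'I_n -> R -> R) (s : R) :
  (forall i j, phis i j s = 1) -> pointwise_min phis s = 1.
Proof.
move=> H; apply/le_anti/andP; split; first exact: bigmin_le_id.
by apply: le_bigmin => // i _; apply: le_bigmin => // j _; rewrite H.
Qed.

Lemma interpolation_ge (R : realType) (n : nat) (P Q : 'M[R]_n)
    (phis : 'I_n -> 'I_n -> R -> R) (s c : R) :
  is_transition P -> is_transition Q ->
  (forall i j, 0 <= phis i j s <= 1) -> c <= pointwise_min phis s ->
  forall i j, c * Q i j <= interpolation P Q phis s i j.
Proof.
move=> tP tQ phi01 cs i j; rewrite mxE.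
have P0 : 0 <= P i j by have [+ _] := tP i => /(_ j); rewrite mxE.
have Q0 : 0 <= Q i j by have [+ _] := tQ i => /(_ j); rewrite mxE.
rewrite ler_wpDl //; first by rewrite mulr_ge0 // subr_ge0; case/andP: (phi01 i j).
by rewrite ler_wpM2r // (le_trans cs) // pointwise_min_le.
Qed.

(** * Mixing time, adiabatic time and the scale of the bound *)

(** A nonempty set of naturals has a least element, so the infimum is attained. Minimality is
    applied later at time 0, to bound [eps]. *)
Lemma mixing_time_fin (R : realType) (n : nat) (P : 'M[R]_n) (pi : 'rV[R]_n)
    (e : R) (t : nat) :
  (forall nu, is_distribution nu -> tv_dist (nu *m P ^+ t) pi <= e) ->
  exists2 t0 : nat, mixing_time P pi e = t0%:R%:E &
    (forall nu, is_distribution nu -> tv_dist (nu *m P ^+ t0) pi <= e) /\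
    forall t1, (t1 < t0)%N -> exists2 nu,
      is_distribution nu & e < tv_dist (nu *m P ^+ t1) pi.
Proof.
move=> et.
pose E t := `[< forall nu, is_distribution nu -> tv_dist (nu *m P ^+ t) pi <= e >].
have exE : exists t, E t by exists t; apply/asboolP.
case: (ex_minnP exE) => t0 /asboolP Et0 min_t0; exists t0.
  apply/le_anti/andP; split; first by apply: ereal_inf_lbound; exists t0.
  apply/ereal_infP => _ [t1 Et1 <-]; rewrite lee_fin ler_nat.
  by apply: min_t0; apply/asboolP.
split=> // t1 t1t0; apply: contrapT => noNu.
have : E t1.
  apply/asboolP => nu dnu; rewrite leNgt; apply/negP => lt.
  by apply: noNu; exists nu.
by move/min_t0; rewrite leqNgt t1t0.
Qed.

(* Only the last t factors are compared with Q; the earlier ones merely change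
   the starting distribution. *)
Lemma tv_dist_inhomogeneous (R : realType) (n : nat) (P : nat -> 'M[R]_n)
    (Q : 'M[R]_n) (pi : 'rV[R]_n) (T t : nat) (b e : R) (nu : 'rV[R]_n) :
  is_transition Q -> (forall k, (0 < k <= T)%N -> is_transition (P k)) ->
  (t <= T)%N -> 0 <= b <= 1 ->
  (forall k i j, (T - t < k <= T)%N -> (1 - b) * Q i j <= P k i j) ->
  (forall mu, is_distribution mu -> tv_dist (mu *m Q ^+ t) pi <= e) ->
  is_distribution nu ->
  tv_dist (nu *m \prod_(1 <= k < T.+1) P k) pi <= t%:R * b + e.
Proof.
move=> tQ tP tT b01 bQP mix dnu.
have Q0 i j : 0 <= Q i j by have [+ _] := tQ i => /(_ j); rewrite mxE.
rewrite (@big_cat_nat _ _ _ (T - t).+1) ?ltnS ?leq_subr //= mulmxA.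
set mu := nu *m _.
have dmu : is_distribution mu.
  apply: mulmx_distribution => //; apply: transition_prod => k.
  rewrite mem_index_iota ltnS => /andP[k0 kT]; apply: tP.
  by rewrite k0 (leq_trans kT) ?leq_subr.
apply: le_trans (tv_dist_triangle _ (mu *m Q ^+ t) _) _.
rewrite lerD ?mix //.
apply: le_trans (_ : 1 - (1 - b) ^+ t <= _); last first.
  by have := bernoulli_ineq t b01; lra.
apply: tv_dist_minorized.
- apply: mulmx_distribution => //; apply: transition_prod => k.
  rewrite mem_index_iota ltnS => /andP[k0 kT]; apply: tP.
  by rewrite kT (leq_trans _ k0).
- by apply: mulmx_distribution => //; apply: transition_exp.
- by apply: exprn_ile1; lra.
move=> j; rewrite !mxE mulr_sumr ler_sum // => i _.
rewrite mulrCA ler_wpM2l //; first by have [] := dmu.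
(* The range from [(T - t).+1] to [T] has exactly [t] factors because [t <= T]. *)
have := @prod_ge_exp R n _ (index_iota (T - t).+1 T.+1) P Q (1 - b) _ Q0 _ i j.
rewrite size_iota subSS subKn //; apply; first by lra.
by move=> k a c; rewrite mem_index_iota ltnS => kT; apply: bQP.
Qed.

Lemma adiabatic_time_le (R : realType) (n : nat) (P : R -> 'M[R]_n)
    (pi : 'rV[R]_n) (eps : R) (T : nat) :
  (forall nu, is_distribution nu ->
    tv_dist (nu *m \prod_(1 <= t < T.+1) P (t%:R / T%:R)) pi <= eps) ->
  (adiabatic_time P pi eps <= T%:R%:E)%E.
Proof.
move=> H; apply: ereal_inf_lbound; exists T => //.
by apply: ge_ereal_sup => _ [nu dnu <-]; rewrite lee_fin H.
Qed.

(** Raising the claimed rate to the power [m] clears the real exponents, so the comparison with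
    [T ^+ m] takes place among integer powers. *)
Lemma adiabatic_scale_expr (R : realType) (m t : nat) (e : R) : (0 < m)%N -> 0 < e ->
  (t%:R `^ (m.+1%:R / m%:R) / e `^ m%:R^-1) ^+ m = t%:R ^+ m.+1 / e.
Proof.
move=> m0 e0; have mN0 : m%:R != 0 :> R by rewrite pnatr_eq0 -lt0n.
rewrite expr_div_n -!powR_mulrn ?powR_ge0 // -!powRrM mulVf // divfK //.
by rewrite powRr1 ?ltW // powR_mulrn.
Qed.

Lemma adiabatic_scale_ge (R : realType) (m t : nat) (e : R) :
  (0 < m)%N -> (0 < t)%N -> 0 < e -> e < 2 ->
  t%:R <= 2 * (t%:R `^ (m.+1%:R / m%:R) / e `^ m%:R^-1) :> R.
Proof.
move=> m0 t0 e0 e2; have m1 : 1 <= m%:R :> R by rewrite ler1n.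
have e_le2 : e `^ m%:R^-1 <= 2.
  have minv0 : 0 <= m%:R^-1 :> R by rewrite invr_ge0 ler0n.
  apply: le_trans (_ : 2 `^ m%:R^-1 <= _).
    by apply: ge0_ler_powR; rewrite ?nnegrE ?(ltW e0) ?(ltW e2).
  rewrite -[leRHS]powRr1 //; apply: ler_powR; first by rewrite ler1n.
  by rewrite invf_le1 // (lt_le_trans ltr01).
have t_le : t%:R <= t%:R `^ (m.+1%:R / m%:R) :> R.
  rewrite -[leLHS]powRr1 ?ler0n //; apply: ler_powR; first by rewrite ler1n.
  by rewrite ler_pdivlMr ?mul1r ?ler_nat // (lt_le_trans ltr01).
rewrite mulrA ler_pdivlMr ?powR_gt0 // mulrC.
by rewrite ler_pM ?powR_ge0 ?ler0n.
Qed.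

(** * The bound on the adiabatic time *)

Theorem theorem1 (R : realType) (phi : R -> R) (m : nat)
    (m_ge1 : (1 <= m)%N)
    (phi_smooth : continuously_derivable_near `[0, 1] m.+1 phi 1)
    (phi_flat : forall k : nat, (1 <= k < m)%N ->
       derive_onn `[0, 1] k phi 1 = 0)
    (phi_m : derive_onn `[0, 1] m phi 1 <> 0) :
  exists2 C : R, 0 < C &
  forall (n : nat) (Pinit Pfinal : 'M[R]_n) (pif : 'rV[R]_n)
    (phis : 'I_n -> 'I_n -> R -> R),
  is_transition Pinit ->
  is_transition Pfinal ->
  is_unique_stationary Pfinal pif ->
  (forall i j, {within `[0, 1], continuous (phis i j)}) ->
  (forall i j s, 0 <= s <= 1 -> 0 <= phis i j s <= 1) ->
  (forall i j, phis i j 0 = 0) ->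
  (forall i j, phis i j 1 = 1) ->
  (forall s, 0 <= s <= 1 -> is_transition (interpolation Pinit Pfinal phis s)) ->
  (forall s, 0 <= s <= 1 -> phi s = pointwise_min phis s) ->
  forall eps : R, 0 < eps ->
  (adiabatic_time (interpolation Pinit Pfinal phis) pif eps
   <= C%:E * mixing_time Pfinal pif (eps / 2) `^ (m.+1%:R / m%:R)
      * ((eps `^ m%:R^-1)^-1)%:E)%E.
Proof.
have [d [M [d0 d1 M0 phiM]]] := flat_unit_bound m_ge1 phi_smooth phi_flat.
have d2 : 0 < 2 / d by rewrite divr_gt0.
(* The summand [2 / d] places the last [t] steps within [d] of time 1, [2 * M] makes [t * b] small,
   and 1 ensures [K <= K ^+ m]. The constant depends only on [phi] and [m], not on the chain. *)
pose K := 2 / d + 2 * M + 1.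
have K1 : 1 <= K by rewrite /K; lra.
(* The extra 2 pays for rounding [K * X] up to an integer, since [1 <= t <= 2 * X]. *)
exists (K + 2); first by rewrite ltr_pwDr // (le_trans ler01).
move=> n Pinit Pfinal pif phis tPi tPf [dpif _ _] _ phi01 _ phi1 tP phiE eps eps0.
have phi_1 : phi 1 = 1.
  by rewrite phiE ?ler01 ?lexx // pointwise_min_eq1.
have r0 : m.+1%:R / m%:R != 0 :> R.
  by rewrite mulf_neq0 ?invr_eq0 ?pnatr_eq0 // -lt0n.
have mroot0 : 0 < (eps `^ m%:R^-1)^-1 by rewrite invr_gt0 powR_gt0.
(* If the chain never mixes, the right-hand side is [+oo]: the exponent is nonzero and the other
   factors are positive. *)
have [[t0 mix0]|nomix] := pselect (exists t, forall nu : 'rV[R]_n,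
  is_distribution nu -> tv_dist (nu *m Pfinal ^+ t) pif <= eps / 2); last first.
  have -> : mixing_time Pfinal pif (eps / 2) = +oo%E.
    rewrite /mixing_time (_ : [set t : nat | _] = set0) ?image_set0 ?ereal_inf0 //.
    by apply/seteqP; split => // t Et; apply: nomix; exists t.
  rewrite poweRyr // gt0_muley ?gt0_mulye ?leey ?lte_fin //.
  by rewrite ltr_pwDr // (le_trans ler01).
have [t -> [mix tmin]] := mixing_time_fin mix0.
rewrite poweR_EFin -!EFinM -mulrA.
set X := _ `^ _ / _.
(* For [t = 0] every distribution is already [eps / 2]-close to [pif], so the empty product,
   [T = 0], works. *)
have [t_eq0|t_gt0] := posnP t.
  apply: le_trans (_ : 0%:R%:E <= _)%E.
    apply: adiabatic_time_le => nu dnu; rewrite big_nil.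
    have := mix nu dnu; rewrite t_eq0 expr0; lra.
  by rewrite lee_fin mulr_ge0 ?divr_ge0 ?powR_ge0 // addr_ge0 // (le_trans ler01).
(* Total variation is at most 1, so a positive mixing time forces eps < 2; this
   keeps X bounded below and absorbs the rounding of T. *)
have eps2 : eps < 2.
  have [nu dnu] := tmin 0%N t_gt0; rewrite expr0 mulmx1.
  by have := tv_dist_le1 dnu dpif; lra.
have tX : t%:R <= 2 * X by apply: adiabatic_scale_ge.
have t1 : 1 <= t%:R :> R by rewrite ler1n.
have Xm : X ^+ m = t%:R ^+ m.+1 / eps by apply: adiabatic_scale_expr.
clearbody X.
pose T := (Num.trunc (K * X)).+1.
have KX0 : 0 <= K * X by rewrite mulr_ge0 //; lra.
have TK : K * X <= T%:R by rewrite ltW // truncnS_gt.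
have TC : T%:R <= (K + 2) * X.
  have : T%:R <= K * X + 1 by rewrite -natr1 lerD2r truncn_le.
  lra.
apply: le_trans (_ : T%:R%:E <= _)%E; last by rewrite lee_fin.
clearbody T.
have T0 : 0 < T%:R :> R.
  by apply: lt_le_trans TK; rewrite mulr_gt0 //; lra.
(* This puts the rescaled times of the last [t] steps in [[1 - d, 1]], where [phiM] applies; it
   follows from [2 <= d * K] and [t <= 2 * X]. *)
have tdT : t%:R <= d * T%:R.
  apply: le_trans (_ : d * (K * X) <= _); last by rewrite ler_pM2l.
  have dK : 2 <= d * K.
    have -> : d * K = 2 + d * (2 * M + 1) by rewrite /K; field; rewrite gt_eqF.
    by rewrite lerDl mulr_ge0 //; lra.
  by rewrite mulrA (le_trans tX) // ler_wpM2r //; lra.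
have tT : (t <= T)%N.
  by rewrite -(ler_nat R) (le_trans tdT) // ler_piMl; lra.
pose b := M * (t%:R / T%:R) ^+ m.
have tb : t%:R * b <= eps / 2.
  have Tm : 2 * M * (t%:R ^+ m.+1 / eps) <= T%:R ^+ m.
    apply: le_trans (_ : (K * X) ^+ m <= _); last first.
      by rewrite lerXn2r ?nnegrE ?ler0n.
    rewrite exprMn Xm ler_wpM2r //.
      by rewrite divr_ge0 ?exprn_ge0 ?ler0n ?(ltW eps0).
    by apply: le_trans (_ : K <= _); [rewrite /K; lra|rewrite ler_eXnr].
  have -> : t%:R * b = M * t%:R ^+ m.+1 / T%:R ^+ m.
    by rewrite /b exprS expr_div_n !mulrA [t%:R * M]mulrC.
  rewrite ler_pdivrMr ?exprn_gt0 //.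
  have -> : M * t%:R ^+ m.+1 = eps / 2 * (2 * M * (t%:R ^+ m.+1 / eps)).
    by field; rewrite gt_eqF.
  by rewrite ler_pM2l //; lra.
have b0 : 0 <= b by rewrite mulr_ge0 ?exprn_ge0 ?divr_ge0 ?ler0n ?(ltW M0).
(* As [1 <= t], [b <= t * b <= eps / 2 < 1]. *)
have b1 : b <= 1.
  by apply: le_trans (_ : t%:R * b <= _); [rewrite ler_peMl|lra].
have unitT k : (k <= T)%N -> 0 <= (k%:R / T%:R : R) <= 1.
  by move=> kT; rewrite divr_ge0 ?ler0n //= ler_pdivrMr // mul1r ler_nat.
apply: adiabatic_time_le => nu dnu.
apply: le_trans (_ : t%:R * b + eps / 2 <= _); last by lra.
apply: (@tv_dist_inhomogeneous _ _
  (fun k => interpolation Pinit Pfinal phis (k%:R / T%:R)) Pfinal) => //.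
- by move=> k /andP[_ kT]; apply/tP/unitT.
- by rewrite b0.
move=> k i j /andP[Tk kT]; apply: interpolation_ge => // [a c|].
  exact/phi01/unitT.
rewrite -phiE ?unitT //.
have kT1 : 1 - k%:R / T%:R <= t%:R / T%:R :> R.
  rewrite lerBlDl -mulrDl ler_pdivlMr // mul1r -natrD ler_nat.
  by rewrite addnC -leq_subLR ltnW.
have : `|phi 1 - phi (k%:R / T%:R)| <= M * (1 - k%:R / T%:R) ^+ m.
  have /andP[_ kT01] := unitT k kT.
  apply: phiM; rewrite kT01 andbT. rewrite lerBlDl -lerBlDr (le_trans kT1) //.
  by rewrite ler_pdivrMr.
rewrite phi_1 ler_norml => /andP[_ bound].
have : M * (1 - k%:R / T%:R) ^+ m <= b.
  rewrite ler_pM2l // lerXn2r ?nnegrE // ?subr_ge0 ?divr_ge0 ?ler0n //.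
  by have /andP[] := unitT k kT.
lra.
Qed.
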